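(* Let $H$ be the triforce graph and let $\ell=\frac{\log(1/p)}{2\log\log(1/p)}$. Then, as $p\to 0$, $$f(H,p)=\Omega\!\left(p^{-2}/\ell^{4}\right).$$
   Context: Subgraph query problem: $G\sim G(\infty,p)$ is the Erdős–Rényi random graph on a countably infinite vertex set, each pair being an edge independently with probability $p\in(0,1)$. A querying strategy adaptively asks queries of the form ''is $(u,v)\in E(G)$?'', each query being allowed to depend on the answers to the previous ones. A copy of $H$ is found when all edges of some copy of $H$ in $G$ have been queried (and answered positively). $f(H,p)$ is the smallest number of queries for which some strategy finds a copy of $H$ in $G(\infty,p)$ with probability at least $\tfrac12$. The triforce is the graph on $6$ vertices and $9$ edges obtained from the triangle $K_3$ by adding, for each of the three pairs of vertices of the triangle, one new vertex adjacent to exactly the two vertices of that pair. $\log$ is the natural logarithm. *)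

(* Defs.v *)
From HB Require Import structures.
From mathcomp Require Import all_boot all_order all_algebra.
From mathcomp Require Import all_classical all_reals all_analysis.

Set Implicit Arguments.
Unset Strict Implicit.
Unset Printing Implicit Defensive.

Import Order.TTheory GRing.Theory Num.Theory.
Import numFieldNormedType.Exports.

Local Open Scope classical_set_scope.
Local Open Scope ring_scope.

(* [G] is a realization, on the probability space (T, P), of the random graph
   G(oo, p), with vertex set [nat].  Unordered pairs of distinct vertices are
   represented by pairs (u, v) with u < v; [er_indep] is mutual independence of
   the edge events, as the product rule over every finite subfamily. *)
Record erdos_renyi (d : measure_display) (T : measurableType d) (R : realType)
    (P : probability T R) (p : R) (G : T -> rel nat) : Prop := ErdosRenyi {
  er_sym : forall w : T, symmetric (G w);
  er_irrefl : forall w : T, irreflexive (G w);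
  er_measurable : forall u v : nat, measurable [set w : T | G w u v];
  er_prob : forall u v : nat, u != v -> P [set w : T | G w u v] = p%:E;
  er_indep : forall s : seq (nat * nat),
    uniq s -> all (fun e => e.1 < e.2)%N s ->
    P [set w : T | forall e, e \in s -> G w e.1 e.2] =
      (\prod_(e <- s) P [set w : T | G w e.1 e.2])%E }.

(* A strategy maps the list of the answers received so far, oldest first, to
   the next pair to query.  Earlier queries are determined by these answers, so
   they need not be passed as well. *)
Definition strategy := seq bool -> nat * nat.

Fixpoint answers (S : strategy) (g : rel nat) (n : nat) : seq bool :=
  if n is m.+1 then
    let a := answers S g m in rcons a (g (S a).1 (S a).2)
  else [::].

Definition queries (S : strategy) (g : rel nat) (n : nat) : seq (nat * nat) :=
  [seq S (answers S g i) | i <- iota 0 n].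

(* Copies are not required to be induced; a queried pair counts in either
   orientation. *)
Definition finds (V : finType) (H : rel V) (g : rel nat) (S : strategy)
    (n : nat) : Prop :=
  exists2 phi : V -> nat, injective phi &
    forall x y : V, H x y ->
      g (phi x) (phi y) /\
      (((phi x, phi y) \in queries S g n) ||
       ((phi y, phi x) \in queries S g n)).

(* The infimum is over a set of natural numbers, hence a minimum when that set
   is nonempty.  The value depends on (P, G) only through the law of G. *)
Definition query_number (d : measure_display) (T : measurableType d)
    (R : realType) (P : probability T R) (G : T -> rel nat)
    (V : finType) (H : rel V) : \bar R :=
  ereal_inf [set n%:R%:E | n in [set n : nat | exists S : strategy,
    ((2^-1)%:E <= P [set w : T | finds H (G w) S n])%E]].

(* [inl i] are the vertices of the triangle; [inr k] is the vertex added for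
   the pair of triangle vertices other than [inl k]. *)
Definition triforce : rel ('I_3 + 'I_3) := fun x y =>
  match x, y with
  | inl i, inl j => i != j
  | inl i, inr k => i != k
  | inr k, inl i => i != k
  | inr _, inr _ => false
  end.

Definition ell (R : realType) (p : R) : R :=
  ln (p^-1) / (2 * ln (ln (p^-1))).

(* Main.v *)
Require Import Defs.
From HB Require Import structures.
From mathcomp Require Import all_boot all_order all_algebra.
From mathcomp Require Import all_classical all_reals all_analysis.
From mathcomp Require Import zify ring lra.

(* With n <= p^-2 / l^4 queries there are about p n edges, hence M edges with
   p M = O(l^-4), where l = ell p.  A query can only increase a codegree if it
   is one of O(M) queries, and codegrees are therefore O(l): binomial tails
   decay like l^-k, which beats the polynomial number of pairs once k >> l
   because l^l >= p^(-1/4).  For the same reason each vertex b is an endpoint of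
   few "tips", i.e. diamonds (b, a, c), (y, a, c) with b outside the common
   edge: the number of such a is at most some K = O(l^2).
   The number of pairs with two common neighbours is at most proportional to
   the number of 4-cycles; each is closed by a query joining the ends of a path
   with three edges, and there are at most (2 M)^2 of those, so O(p M^2) 4-cycles.
   The last edge of a triforce either is an edge of the triangle, and then joins
   a pair with two common neighbours, or is an edge (a, x) with x outside the
   triangle, and then x is a neighbour of some b for which a is a tip.  So at
   most O(p M^2) + 2 M K queries can complete a triforce, which is o(1 / p), and
   each of them succeeds with probability p. *)

Import Order.TTheory GRing.Theory Num.Theory.
Import numFieldNormedType.Exports.

(** * Query histories and the graph of edges found so far *)

Section Combinatorics.

(* A history is the list of answers, newest first, so that it grows by [cons];
   [Q r] is the pair asked after the history [r]. *)
Variable Q : seq bool -> nat * nat.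

Definition swap (e : nat * nat) : nat * nat := (e.2, e.1).

Definition asks r x y : bool := (Q r == (x, y)) || (Q r == (y, x)).

Fixpoint asked (r : seq bool) : seq (nat * nat) :=
  if r is _ :: r' then Q r' :: asked r' else [::].

(* Only fresh queries have a random answer; the graph and all counts below
   ignore the others. *)
Definition fresh (r : seq bool) : bool :=
  [&& (Q r).1 != (Q r).2, Q r \notin asked r & swap (Q r) \notin asked r].

Fixpoint arcs (r : seq bool) : seq (nat * nat) :=
  if r is t :: r' then
    (if t && fresh r' then [:: Q r'; swap (Q r')] else [::]) ++ arcs r'
  else [::].

Definition adj r x y : bool := (x, y) \in arcs r.

(** [f] is read at the history before the query, so it is known in advance; hence [hits f] minus [p]
    times [trials f] is a martingale. Values of [f] above 1 count several configurations created by
    one edge. *)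
Fixpoint hits (f : seq bool -> nat) (r : seq bool) : nat :=
  if r is t :: r' then (if t && fresh r' then f r' else 0) + hits f r' else 0.

Fixpoint trials (f : seq bool -> nat) (r : seq bool) : nat :=
  if r is t :: r' then (if fresh r' then f r' else 0) + trials f r' else 0.

Lemma swapK : involutive swap. Proof. by case. Qed.

Lemma asksC r x y : asks r x y = asks r y x.
Proof. by rewrite /asks orbC. Qed.

Lemma asks_inj r x y x' y' : asks r x y -> asks r x' y' ->
  (x = x' /\ y = y') \/ (x = y' /\ y = x').
Proof. by rewrite /asks => /orP[]/eqP -> /orP[]/eqP [-> ->]; auto. Qed.

Lemma asks_fresh r x y : fresh r -> asks r x y -> x <> y.
Proof. by move=> /and3P[ne _ _] /orP[]/eqP h e; move: ne; rewrite h /= e eqxx. Qed.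

Lemma adj_cons t r x y :
  adj (t :: r) x y = adj r x y || (t && fresh r) && asks r x y.
Proof.
rewrite /adj /= mem_cat orbC; case: ifP => //= _.
rewrite !inE /asks /swap; case: (Q r) => u v /=.
by rewrite !xpair_eqE (eq_sym x u) (eq_sym y v) (eq_sym x v) (eq_sym y u) [(v == x) &&
    _]andbC.
Qed.

Lemma adj_sym r x y : adj r x y = adj r y x.
Proof. by elim: r => // t r IH; rewrite !adj_cons IH asksC. Qed.

Lemma adj_neq r x y : adj r x y -> x <> y.
Proof.
elim: r => // t r IH; rewrite adj_cons => /orP[/IH//|/andP[/andP[_ fr]]].
exact: asks_fresh.
Qed.

Lemma arcs_mono r t : {subset arcs r <= arcs (t :: r)}.
Proof. by move=> e he /=; rewrite mem_cat he orbT. Qed.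

Lemma adj_mono r t x y : adj r x y -> adj (t :: r) x y.
Proof. exact: arcs_mono. Qed.

Lemma arcs_asked r e : e \in arcs r -> (e \in asked r) || (swap e \in asked r).
Proof.
elim: r => //= t r IH; rewrite mem_cat !in_cons => /orP[|/IH/orP[]->]; rewrite ?orbT //.
by case: ifP => // _; rewrite !inE => /orP[]/eqP->; rewrite ?swapK eqxx ?orbT.
Qed.

Lemma arcs_uniq r : uniq (arcs r).
Proof.
elim: r => //= t r IH; case: ifP => //= /andP[_ /and3P[ne n1 n2]].
rewrite IH andbT inE negb_or; apply/andP; split; last first.
  by apply/negP => /arcs_asked; rewrite swapK (negbTE n1) (negbTE n2).
apply/andP; split; last by apply/negP => /arcs_asked; rewrite (negbTE n1) (negbTE n2).
by apply: contra ne; rewrite /swap; case: (Q r) => u v /=; rewrite xpair_eqE => /andP[].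
Qed.

Lemma size_arcs r : size (arcs r) = 2 * hits (fun=> 1) r.
Proof. by elim: r => //= t r IH; rewrite size_cat IH; case: ifP => //= _; lia. Qed.

Definition nbrs r u : seq nat := [seq e.2 | e <- arcs r & e.1 == u].

Lemma mem_nbrs r u x : (x \in nbrs r u) = adj r u x.
Proof.
apply/mapP/idP => [[[a b]]|h]; first by rewrite mem_filter /= => /andP[/eqP-> h ->].
by exists (u, x); rewrite // mem_filter eqxx.
Qed.

Lemma nbrs_uniq r u : uniq (nbrs r u).
Proof.
rewrite map_inj_in_uniq ?filter_uniq ?arcs_uniq // => -[a b] [c d].
by rewrite !mem_filter /= => /andP[/eqP-> _] /andP[/eqP-> _] ->.
Qed.

Lemma size_nbrs r u : size (nbrs r u) <= size (arcs r).
Proof. by rewrite size_map size_filter count_size. Qed.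

(** * Common neighbours and codegrees *)

Definition common_nbrs r u v : seq nat := [seq x <- nbrs r u | adj r v x].

Lemma mem_common_nbrs r u v x : (x \in common_nbrs r u v) = adj r u x && adj r v x.
Proof. by rewrite mem_filter mem_nbrs andbC. Qed.

Lemma common_nbrs_uniq r u v : uniq (common_nbrs r u v).
Proof. by rewrite filter_uniq ?nbrs_uniq. Qed.

Lemma common_nbrs_mono r t u v : {subset common_nbrs r u v <= common_nbrs (t :: r) u v}.
Proof. by move=> x; rewrite !mem_common_nbrs => /andP[h1 h2]; rewrite !adj_mono. Qed.

Definition codeg_le k r := forall u v, u != v -> size (common_nbrs r u v) <= k.

Lemma codeg_le_cons k t r : codeg_le k (t :: r) -> codeg_le k r.
Proof.
by move=> h u v /h; apply: leq_trans; rewrite uniq_leq_size ?common_nbrs_uniq //;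
    apply: common_nbrs_mono.
Qed.

(** Fresh queries are pairwise distinct even up to orientation, and [L] only grows, so those made
    while [D] held all lie in the final [L r] or among its swaps. *)
Lemma trials_le (D : seq bool -> bool) (L : seq bool -> seq (nat * nat)) :
  (forall r t, {subset L r <= L (t :: r)}) ->
  (forall r, D r -> exists x y, asks r x y /\ (x, y) \in L r) ->
  forall r, trials D r <= 2 * size (L r).
Proof.
move=> Lm DL r.
pose cl := fix cl (r : seq bool) : seq (nat * nat) :=
  if r is _ :: r' then (if fresh r' && D r' then [:: Q r'] else [::]) ++ cl r' else [::].
have clq r' : {subset cl r' <= asked r'}.
  elim: r' => //= t r' IH e; rewrite mem_cat in_cons => /orP[|/IH->]; rewrite ?orbT //.
  by case: ifP => // _; rewrite inE => ->.
have clu r' : uniq (cl r').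
  elim: r' => //= t r' IH; case: ifP => //= /andP[/and3P[_ n _] _].
  by rewrite IH andbT; apply: contra n => /clq.
have cls r' : trials D r' = size (cl r').
  by elim: r' => //= t r' IH; rewrite size_cat IH; case: fresh => //=; case: (D r').
have clL r' : {subset cl r' <= L r' ++ map swap (L r')}.
  elim: r' => //= t r' IH e; rewrite mem_cat => /orP[|/IH]; last first.
    rewrite !mem_cat => /orP[/Lm->//|/mapP[e' /Lm h ->]].
    by rewrite map_f ?orbT.
  case: ifP => // /andP[_ /DL[x [y [q h]]]]; rewrite inE => /eqP->.
  rewrite mem_cat; case/orP: q => /eqP->; first by rewrite Lm.
  by rewrite (map_f swap (Lm _ t _ h)) orbT.
rewrite cls; have -> : 2 * size (L r) = size (L r ++ map swap (L r)).
  by rewrite size_cat size_map; lia.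
exact: uniq_leq_size.
Qed.

Definition closes_cherry u v r : bool :=
  `[< exists y, (asks r u y /\ adj r v y) \/ (asks r v y /\ adj r u y) >].

(** An edge creates at most one common neighbour of [u] and [v]: it must join one of them to a
    neighbour of the other, and that neighbour is the only new one. *)
Lemma codeg_hits u v r : u != v -> size (common_nbrs r u v) <= hits (closes_cherry u v) r.
Proof.
move=> uv; elim: r => // t r IH.
have nloop z : ~ adj (t :: r) z z by move=> /adj_neq.
rewrite /=; case: (boolP (t && fresh r)) => [hit|nhit]; last first.
  apply: leq_trans IH; apply: uniq_leq_size; first exact: common_nbrs_uniq.
  by move=> z; rewrite !mem_common_nbrs !adj_cons (negbTE nhit) /= !orbF.
case/andP: (hit) => _ fr.
have irr z w : asks r z w -> z <> w by apply: asks_fresh.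
rewrite /closes_cherry; case: asboolP => [[w hw]|nD].
  apply: leq_trans (_ : size (w :: common_nbrs r u v) <= _);
      last by rewrite /= add1n ltnS.
  apply: uniq_leq_size; first exact: common_nbrs_uniq.
  move=> z; rewrite inE !mem_common_nbrs => /andP[hu hv].
  have zu : z <> u by move=> e; apply: (nloop u); rewrite -{2}e.
  have zv : z <> v by move=> e; apply: (nloop v); rewrite -{2}e.
  move: hu hv; rewrite !adj_cons hit /=.
  move=> /orP[hu|hu] /orP[hv|hv]; first by rewrite hu hv orbT.
  - case: hw => -[hq _]; case: (asks_inj _ _ _ _ _ hq hv) => -[e1 e2]; subst;
      try (by rewrite eqxx in uv); try by rewrite eqxx.
    by case: zu.
  - case: hw => -[hq _]; case: (asks_inj _ _ _ _ _ hq hu) => -[e1 e2]; subst;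
      try (by rewrite eqxx in uv); try by rewrite eqxx.
    by case: zv.
  - case: (asks_inj _ _ _ _ _ hu hv) => -[e1 e2]; subst;
      by [rewrite eqxx in uv|case: zu|case: zv].
rewrite add0n; apply: leq_trans IH; apply: uniq_leq_size; first exact: common_nbrs_uniq.
move=> z; rewrite !mem_common_nbrs => /andP[hu hv].
have zu : z <> u by move=> e; apply: (nloop u); rewrite -{2}e.
have zv : z <> v by move=> e; apply: (nloop v); rewrite -{2}e.
move: hu hv; rewrite !adj_cons hit /=.
move=> /orP[hu|hu] /orP[hv|hv]; first by rewrite hu hv.
- by case: nD; exists z; right.
- by case: nD; exists z; left.
- case: (asks_inj _ _ _ _ _ hu hv) => -[e1 e2]; subst;
    by [rewrite eqxx in uv|case: zu|case: zv].
Qed.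

(** Each relevant query joins [u] to a neighbour of [v] or conversely; degrees are bounded crudely
    by the number of arcs, twice the number of edges. *)
Lemma codeg_count u v r :
  trials (closes_cherry u v) r <= 8 * hits (fun=> 1) r.
Proof.
pose L r := [seq (u, y) | y <- nbrs r v] ++ [seq (v, y) | y <- nbrs r u].
apply: leq_trans (trials_le (closes_cherry u v) L _ _ r) _.
- move=> {}r t e; rewrite !mem_cat => /orP[]/mapP[y hy ->]; apply/orP; [left|right];
  by apply: map_f; move: hy; rewrite !mem_nbrs; apply: adj_mono.
- move=> {}r /asboolP[y [[q a]|[q a]]]; [exists u, y|exists v, y]; split => //.
    by rewrite mem_cat map_f ?mem_nbrs.
  by rewrite mem_cat [X in _ || X]map_f ?mem_nbrs ?orbT.
- rewrite size_cat (size_map (pair u)) (size_map (pair v)).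
  have := size_nbrs r u; have := size_nbrs r v; rewrite size_arcs; lia.
Qed.

(** * Diamonds near a vertex and their tips *)

Lemma size_allpairs_dep_le (S T U : eqType) (f : S -> T -> U) (s : seq S) (g : S -> seq
    T) k :
  (forall x, x \in s -> size (g x) <= k) ->
  size [seq f x y | x <- s, y <- g x] <= size s * k.
Proof.
elim: s => //= x s IH h; rewrite size_cat size_map mulSn leq_add ?h ?mem_head //.
by apply: IH => y ys; apply: h; rewrite inE ys orbT.
Qed.

(* Contains every query that can complete a diamond with tip [b]. *)
Definition closes_near b r : bool :=
  `[< exists x y w, [/\ asks r x y, w <> b, adj r w x, adj r w y & x = b \/ adj r b x] >].

(** Fix an arc [(w, y)]. The query is either [(b, y)], or [(x, y)] with [x] one of the at most [k]
    common neighbours of [b] and [w]: [k.+1] choices per arc. *)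
Lemma near_count k b r : codeg_le k r ->
  trials (closes_near b) r <= 4 * hits (fun=> 1) r * k.+1.
Proof.
pose L r := [seq (b, e.2) | e <- arcs r] ++
  [seq (e.2, v) | e <- arcs r, v <- if e.1 == b then [::] else common_nbrs r b e.1].
move=> hk; apply: leq_trans (trials_le (closes_near b) L _ _ r) _.
- move=> r' t e; rewrite !mem_cat => /orP[/mapP[y hy ->]|/allpairsPdep[e' [v [he hv
    ->]]]].
    by rewrite (map_f (fun e => (b, e.2)) (arcs_mono _ t _ hy)).
  apply/orP; right; apply/allpairsPdep; exists e', v; split=> //; first exact: arcs_mono.
  by move: hv; case: ifP => // _; apply: common_nbrs_mono.
- move=> r' /asboolP[x [y [w [q wb wx wy [xb|bx]]]]].
    exists x, y; split => //; rewrite mem_cat xb; apply/orP; left.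
    by apply/mapP; exists (w, y).
  exists y, x; split; first by rewrite asksC.
  rewrite mem_cat; apply/orP; right; apply/allpairsPdep; exists (w, y), x; split => //=.
  by case: eqP => // _; rewrite mem_common_nbrs bx.
- rewrite size_cat size_map.
  have h : size [seq (e.2, v) | e <- arcs r, v <- if e.1 == b then [::] else
      common_nbrs r b e.1]
      <= size (arcs r) * k.
    apply: size_allpairs_dep_le => e _; case: eqP => // /eqP eb.
    by apply: hk; rewrite eq_sym.
  by move: h; rewrite size_arcs; nia.
Qed.

(** The triangles [bac] and [yac] share the edge [ac]. For a triforce on the triangle [abc], [y] is
    a candidate for the outer vertex over [ac]; a query at [a] may then supply the outer vertex over
    [ab]. *)
Definition tip r b a : Prop :=
  adj r b a /\ exists c y, [/\ adj r b c, adj r a c, y <> b, adj r y a & adj r y c].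

Lemma tip_mono t r b a : tip r b a -> tip (t :: r) b a.
Proof.
by move=> [h [c [y [h1 h2 h3 h4 h5]]]]; split; [|exists c, y; split=> //];
    apply: adj_mono.
Qed.

Definition tips r b : seq nat := [seq a <- nbrs r b | `[< tip r b a >]].

Lemma mem_tips r b a : (a \in tips r b) = `[< tip r b a >].
Proof.
rewrite mem_filter mem_nbrs andbC; apply: andb_idl => /asboolP[] //.
Qed.

Lemma tips_uniq r b : uniq (tips r b).
Proof. by rewrite filter_uniq ?nbrs_uniq. Qed.

(** The new edge is one of the five of the diamond. If it contains [a], then [a] is an end of the
    query; otherwise it is [bc] or [yc], and [a] is a common neighbour of [b] and the end [c]. *)
Lemma tip_cons t r b a : tip (t :: r) b a -> tip r b a \/
  [/\ t && fresh r, closes_near b r &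
   asks r a a \/ exists x y, [/\ asks r x y & a = x \/ x <> b /\ a \in common_nbrs (t
       :: r) b x]].
Proof.
move=> [ba [c [y [bc ac yb ya yc]]]].
have ba' := adj_neq _ _ _ ba; have bc' := adj_neq _ _ _ bc; have ac' := adj_neq _ _ _ ac.
have ya' := adj_neq _ _ _ ya; have yc' := adj_neq _ _ _ yc.
have cna : a \in common_nbrs (t :: r) b c by rewrite mem_common_nbrs ba adj_sym ac.
case: (boolP (t && fresh r)) => [hit|nhit]; last first.
  left; move: ba bc ac ya yc; rewrite !adj_cons (negbTE nhit) /= !orbF => *.
  by split => //; exists c, y.
move: ba bc ac ya yc; rewrite !adj_cons hit /=.
(* Two different pairs cannot both be the new edge: once one edge of the diamond is the query, the
   other four were present before. *)
have old u v u' v' : asks r u v -> adj r u' v' || asks r u' v' ->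
  ~ ((u = u' /\ v = v') \/ (u = v' /\ v = u')) -> adj r u' v'.
  by move=> q /orP[//|q'] []; apply: asks_inj q q'.
move=> ba bc ac ya yc.
have sq : forall u v, adj r u v -> adj r v u by move=> u v; rewrite adj_sym.
case: (boolP (asks r b a)) => [q|nba].
  right; split => //; last by right; exists a, b; rewrite asksC; split; auto.
  apply/asboolP; exists b, a, c; split; auto.
  - by apply: sq; apply: old q bc _ => ?; intuition congruence.
  - by apply: sq; apply: old q ac _ => ?; intuition congruence.
case: (boolP (asks r b c)) => [q|nbc].
  right; split => //; last by right; exists c, b; rewrite asksC; split; auto.
  apply/asboolP; exists b, c, a; split; auto.
  - by apply: sq; apply: old q ba _ => ?; intuition congruence.
  - by apply: old q ac _ => ?; intuition congruence.
case: (boolP (asks r a c)) => [q|nac].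
  right; split => //; last by right; exists a, c; split; auto.
  apply/asboolP; exists a, c, y; split; auto.
  - by apply: old q ya _ => ?; intuition congruence.
  - by apply: old q yc _ => ?; intuition congruence.
  - by right; apply: old q ba _ => ?; intuition congruence.
case: (boolP (asks r y a)) => [q|nya].
  right; split => //; last by right; exists a, y; rewrite asksC; split; auto.
  apply/asboolP; exists a, y, c; split; auto.
  - by rewrite asksC.
  - by apply: sq; apply: old q ac _ => ?; intuition congruence.
  - by apply: sq; apply: old q yc _ => ?; intuition congruence.
  - by right; apply: old q ba _ => ?; intuition congruence.
case: (boolP (asks r y c)) => [q|nyc].
  right; split => //; last by right; exists c, y; rewrite asksC; split; auto.
  apply/asboolP; exists c, y, a; split; auto.
  - by rewrite asksC.
  - by apply: old q ac _ => ?; intuition congruence.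
  - by apply: sq; apply: old q ya _ => ?; intuition congruence.
  - by right; apply: old q bc _ => ?; intuition congruence.
left; move: ba bc ac ya yc;
    rewrite (negbTE nba) (negbTE nbc) (negbTE nac) (negbTE nya) (negbTE nyc) !orbF => *.
by split => //; exists c, y.
Qed.

(** By [tip_cons] a single hit creates as tips at most its two ends and, for each end other than
    [b], the at most [k] common neighbours of that end and [b]. *)
Lemma size_tips k b r : codeg_le k r ->
  size (tips r b) <= hits (closes_near b) r * (2 * k.+1).
Proof.
elim: r => // t r IH hk; have {}IH := IH (codeg_le_cons _ _ _ hk).
pose other x := if x == b then [::] else common_nbrs (t :: r) b x.
have so x : size (other x) <= k.
  by rewrite /other; case: eqP => // /eqP xb; apply: hk; rewrite eq_sym.
pose new := (Q r).1 :: (Q r).2 :: other (Q r).1 ++ other (Q r).2.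
case: (boolP (t && fresh r && closes_near b r)) => [/andP[hit near]|none].
  apply: leq_trans (_ : size (new ++ tips r b) <= _); last first.
    rewrite /= hit near /= size_cat /= size_cat.
    by have := so (Q r).1; have := so (Q r).2; lia.
  apply: uniq_leq_size; first exact: tips_uniq.
  move=> a; rewrite mem_cat !mem_tips => /asboolP/tip_cons[h|[_ _]].
    by apply/orP; right; apply/asboolP.
  move=> [q|[x [y [q ax]]]].
    by apply/orP; left; rewrite /new; case/orP: q => /eqP->; rewrite inE eqxx.
  apply/orP; left; rewrite /new /other !inE mem_cat; case: ax => [->|[/eqP/negbTE xb h]].
    by case/orP: q => /eqP->; rewrite /= eqxx ?orbT.
  by case/orP: q => /eqP-> /=; rewrite xb h ?orbT.
apply: leq_trans (_ : size (tips r b) <= _); last by apply: leq_trans IH _;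
    rewrite /= mulnDl leq_addl.
apply: uniq_leq_size; first exact: tips_uniq.
move=> a; rewrite !mem_tips => /asboolP/tip_cons[h|[h1 h2 _]]; first exact/asboolP.
by rewrite h1 h2 in none.
Qed.

(** * Four-cycles and pairs with two common neighbours *)

Definition two_common r a b : Prop := exists c x,
  [/\ c <> x, adj r a c, adj r b c, adj r a x & adj r b x].

(* Every [(c, b)] in the list is the middle of a path u - c - b - v, where
   [Q r = (u, v)]. *)
Definition paths3 r : seq (nat * nat) :=
  [seq e <- arcs r | adj r (Q r).1 e.1 && adj r e.2 (Q r).2].

(** Closing the path u - c - b - v gives a four-cycle with opposite pairs [u, b] and [c, v]; each is
    stored in both orientations, whence four entries per path. *)
Fixpoint squares r : seq (nat * nat) :=
  if r is t :: r' then
    (if t && fresh r' then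
       flatten [seq [:: ((Q r').1, e.2); (e.2, (Q r').1);
                        ((Q r').2, e.1); (e.1, (Q r').2)] | e <- paths3 r']
     else [::]) ++ squares r'
  else [::].

Lemma size_squares r : size (squares r) = 4 * hits (fun r => size (paths3 r)) r.
Proof.
elim: r => //= t r IH; rewrite size_cat IH; case: ifP => _ //=.
by rewrite size_flatten /shape -map_comp sumnE big_map /= big_const_seq count_predT
    iter_addn_0; lia.
Qed.

Lemma squares_paths3 t r a b c x : t && fresh r -> asks r a c ->
  adj r c b -> adj r b x -> adj r x a ->
  (a, b) \in squares (t :: r) /\ (b, a) \in squares (t :: r).
Proof.
move=> hit q cb bx xa; rewrite /= hit !mem_cat.
have bc : adj r b c by rewrite adj_sym.
have xb : adj r x b by rewrite adj_sym.
have ax : adj r a x by rewrite adj_sym.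
case/orP: q => /eqP q.
  have h : (x, b) \in paths3 r by rewrite mem_filter q /= ax bc.
  by split; apply/orP; left; apply/flatten_mapP; exists (x, b);
      rewrite // q !inE eqxx ?orbT.
have h : (b, x) \in paths3 r by rewrite mem_filter q /= cb xa.
by split; apply/orP; left; apply/flatten_mapP; exists (b, x);
    rewrite // q !inE eqxx ?orbT.
Qed.

(** The edges between [a, b] and [c, x] form a four-cycle; its latest edge closed a path with three
    edges and put [(a, b)] into the list at that time. *)
Lemma two_common_squares r a b : a <> b -> two_common r a b -> (a, b) \in squares r.
Proof.
move=> ab; elim: r => [[c [x [_]]]//|t r IH [c [x [cx ac bc ax bx]]]].
have ac' := adj_neq _ _ _ ac; have bc' := adj_neq _ _ _ bc.
have ax' := adj_neq _ _ _ ax; have bx' := adj_neq _ _ _ bx.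
case: (boolP (t && fresh r)) => [hit|nhit]; last first.
  rewrite /= (negbTE nhit); apply: IH; exists c, x.
  by move: ac bc ax bx; rewrite !adj_cons (negbTE nhit) /= !orbF.
move: ac bc ax bx; rewrite !adj_cons hit !andTb => ac bc ax bx.
have old u v u' v' : asks r u v -> adj r u' v' || asks r u' v' ->
  ~ ((u = u' /\ v = v') \/ (u = v' /\ v = u')) -> adj r u' v'.
  by move=> q /orP[//|q'] []; apply: asks_inj q q'.
have sq : forall u v, adj r u v -> adj r v u by move=> u v; rewrite adj_sym.
case: (boolP (asks r a c)) => [q|nac].
  have [] // := squares_paths3 t r a b c x hit q.
  - by apply: sq; apply: old q bc _ => ?; intuition congruence.
  - by apply: old q bx _ => ?; intuition congruence.
  - by apply: sq; apply: old q ax _ => ?; intuition congruence.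
case: (boolP (asks r b c)) => [q|nbc].
  have [] // := squares_paths3 t r b a c x hit q.
  - by apply: sq; apply: old q ac _ => ?; intuition congruence.
  - by apply: old q ax _ => ?; intuition congruence.
  - by apply: sq; apply: old q bx _ => ?; intuition congruence.
case: (boolP (asks r a x)) => [q|nax].
  have [] // := squares_paths3 t r a b x c hit q.
  - by apply: sq; apply: old q bx _ => ?; intuition congruence.
  - by apply: old q bc _ => ?; intuition congruence.
  - by apply: sq; apply: old q ac _ => ?; intuition congruence.
case: (boolP (asks r b x)) => [q|nbx].
  have [] // := squares_paths3 t r b a x c hit q.
  - by apply: sq; apply: old q ax _ => ?; intuition congruence.
  - by apply: old q ac _ => ?; intuition congruence.
  - by apply: sq; apply: old q bc _ => ?; intuition congruence.
have h : (a, b) \in squares r.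
  apply: IH; exists c, x; move: ac bc ax bx.
  by rewrite (negbTE nac) (negbTE nbc) (negbTE nax) (negbTE nbx) !orbF.
by rewrite /= mem_cat h orbT.
Qed.

(** A path closed by the query [(u, v)] is encoded by its two outer arcs, which start at [u] and end
    at [v]. They determine the query, hence its time, and the path; so there are at most as many as
    pairs of arcs. *)
Lemma paths3_count r : trials (fun r => size (paths3 r)) r <= (2 * hits (fun=> 1) r) ^ 2.
Proof.
pose cl := fix cl (r : seq bool) := if r is _ :: r' then
  (if fresh r' then [seq (((Q r').1, e.1), (e.2, (Q r').2)) | e <- paths3 r'] else [::])
    ++ cl r' else [::].
have clq r' e : e \in cl r' -> (e.1.1, e.2.2) \in asked r'.
  elim: r' => //= t r' IH; rewrite mem_cat in_cons => /orP[|/IH->]; rewrite ?orbT //.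
  by case: ifP => // _ /mapP[e' _ -> /=]; rewrite -surjective_pairing eqxx.
have clu r' : uniq (cl r').
  elim: r' => //= t r' IH; case: ifP => //= /and3P[_ n _].
  rewrite cat_uniq IH andbT map_inj_uniq => [|[a b] [c d] [-> ->] //].
  rewrite filter_uniq ?arcs_uniq //=; apply/hasPn => e /clq h.
  by apply: contra n => /mapP[e' _ E]; move: h; rewrite E /= -surjective_pairing.
have clE r' e : e \in cl r' -> (e.1 \in arcs r') && (e.2 \in arcs r').
  elim: r' => // t r' IH; rewrite [cl _]/= mem_cat => /orP[|/IH/andP[h1 h2]];
      last by rewrite !arcs_mono.
  case: ifP => // _ /mapP[e' + ->]; rewrite mem_filter => /andP[/andP[h1 h2] _].
  by rewrite !arcs_mono.
have -> : trials (fun r => size (paths3 r)) r = size (cl r).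
  by elim: r => //= t r IH; rewrite size_cat IH; case: ifP => //; rewrite size_map.
rewrite -size_arcs expnS expn1 -(size_allpairs pair).
apply: (uniq_leq_size (clu r)) => -[e1 e2] /clE/andP[h1 h2].
exact: (allpairs_f pair).
Qed.

(** * Queries that complete a triforce *)

Definition closes_triforce r : bool := `[< exists x y, [/\ asks r x y, x <> y &
  two_common r x y \/ exists b, [/\ adj r b x, adj r b y & tip r b x]] >].

(** The first summand covers triangle edges. The second covers edges to an outer vertex: an arc
    leads from [b] to that vertex, and the other end is one of the at most [k] tips for [b]. *)
Lemma closes_triforce_count k r :
  (forall b, size (tips r b) <= k) ->
  trials closes_triforce r <=
    2 * (4 * hits (fun r => size (paths3 r)) r + 2 * hits (fun=> 1) r * k).
Proof.
pose L r := squares r ++ [seq (a, e.2) | e <- arcs r, a <- tips r e.1].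
move=> hk; apply: leq_trans (trials_le closes_triforce L _ _ r) _.
- move=> r' t e; rewrite !mem_cat => /orP[->|]; rewrite ?orbT //.
  move=> /allpairsPdep[e' [a [h1 h2 ->]]]; apply/orP; right.
  apply/allpairsPdep; exists e', a; split => //; first exact: arcs_mono.
  by move: h2; rewrite !mem_tips => /asboolP h; apply/asboolP; apply: tip_mono.
- move=> r' /asboolP[x [y [q xy h]]]; exists x, y; split=> //.
  rewrite mem_cat; case: h => [/(two_common_squares _ _ _ xy)->//|[b [bx bY tx]]].
  apply/orP; right; apply/allpairsPdep; exists (b, y), x.
  by split=> //=; rewrite mem_tips; apply/asboolP.
- rewrite size_cat size_squares -size_arcs leq_mul2l leq_add2l /=.
  exact: size_allpairs_dep_le.
Qed.

Definition found r : Prop := exists2 phi : 'I_3 + 'I_3 -> nat, injective phi &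
  forall x y, triforce x y -> adj r (phi x) (phi y).

Lemma ord3_third (i j : 'I_3) : i != j -> exists2 k, k != i & k != j.
Proof.
have : [forall i : 'I_3, forall j : 'I_3, (i != j) ==> [exists k : 'I_3, (k != i) && (k
    != j)]].
  by apply/forallP => -[[|[|[]]]] // ?; apply/forallP => -[[|[|[]]]] // ?;
      apply/implyP => // _; apply/existsP;
  first [by exists ord0|by exists (@Ordinal 3 1 isT)|by exists (@Ordinal 3 2 isT)].
move=> /forallP/(_ i)/forallP/(_ j)/implyP h /h /existsP[k /andP[]]; by exists k.
Qed.

Lemma found_cons t r : found (t :: r) ->
  found r \/ t && fresh r && closes_triforce r.
Proof.
move=> [phi inj h].
case: (boolP (t && fresh r)) => [hit|nhit]; last first.
  left; exists phi => // x y /h; by rewrite adj_cons (negbTE nhit) orbF.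
case: (boolP [exists x, exists y, triforce x y && asks r (phi x) (phi y)]); last first.
  move=> /existsPn nq; left; exists phi => // x y xy.
  have := h _ _ xy; rewrite adj_cons => /orP[//|/andP[_ q]].
  by have /existsPn/(_ y) := nq x; rewrite xy q.
move=> /existsP[x /existsP[y /andP[xy q]]]; right.
have old z w : triforce z w -> ~ ((x = z /\ y = w) \/ (x = w /\ y = z)) ->
    adj r (phi z) (phi w).
  move=> zw ne; have := h _ _ zw; rewrite adj_cons => /orP[//|/andP[_ q']].
  by case: ne; case: (asks_inj _ _ _ _ _ q q') => -[/inj -> /inj ->]; auto.
(* Every edge of the triforce has an end in the triangle; the query is oriented to start there. *)
wlog [i xi] : x y xy q old / exists i, x = inl i.
  move=> W; case: x xy q old => [i|i] xy q old; first by apply: (W (inl i) y) => //;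
      exists i.
  case: y xy q old => [j|j] //= xy q old; apply: (W (inl j) (inr i)); last by exists j.
  - exact: xy.
  - by rewrite asksC.
  - by move=> z w zw ne; apply: old => // e; apply: ne; case: e => -[-> ->]; auto.
subst x; apply/asboolP; case: y xy q old => [j|k] /= xy q old.
  (* Last edge in the triangle: the two common neighbours are the third vertex and the outer vertex
     over this edge. *)
  have [k /eqP ki /eqP kj] := ord3_third _ _ xy; move/eqP: xy => xy.
  exists (phi (inl i)), (phi (inl j)); split; [by []|by move=> /inj[]|left].
  exists (phi (inl k)), (phi (inr k)).
  by split; [move=> /inj//|apply: old..]; rewrite /=; try (by apply/eqP; auto);
    intuition congruence.
(* Last edge to the outer vertex [inr k]: its other neighbour [inl j] serves as [b], and the
   triangle with [inr j] is the diamond. *)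
have [j /eqP ji /eqP jk] := ord3_third _ _ xy; move/eqP: xy => xy.
exists (phi (inl i)), (phi (inr k)); split; [by []|by move=> /inj|right].
exists (phi (inl j)); split; [apply: old|apply: old|split];
  rewrite /=; try (by apply/eqP; auto); try by intuition congruence.
  by apply: old; rewrite /=; [apply/eqP; auto|intuition congruence].
exists (phi (inl k)), (phi (inr j)); split;
    [apply: old|apply: old|by move=> /inj|rewrite adj_sym; apply: old..];
  rewrite /=; try (by apply/eqP; auto); by intuition congruence.
Qed.

Lemma found_hit r : found r -> 0 < hits closes_triforce r.
Proof.
elim: r => [[phi _ /(_ (inl ord0) (inl ord_max) isT)]//|t r IH /found_cons[/IH
    h|/andP[h1 h2]]] /=.
  by apply: leq_trans h (leq_addl _ _).
by rewrite h1 h2.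
Qed.

End Combinatorics.

Local Open Scope classical_set_scope.
Local Open Scope ring_scope.

(** * Supermartingales on the tree of histories, [w r] being the probability of [r] *)

Section Martingale.

Variable (R : realType) (Q : seq bool -> nat * nat) (p : R) (w : seq bool -> R).
Hypothesis p_gt0 : 0 < p.
Hypothesis w_nil : w [::] = 1.
Hypothesis w_ge0 : forall r, 0 <= w r.
Hypothesis w_cons : forall r, w (true :: r) + w (false :: r) = w r.
Hypothesis w_fresh : forall r, fresh Q r -> w (true :: r) = p * w r.

(** Expanding at the newest answer lets one-step inequalities be applied directly under the sum. *)
Fixpoint sum_hist (n : nat) (F : seq bool -> R) : R :=
  if n is m.+1 then sum_hist m (fun r => F (true :: r) + F (false :: r)) else F [::].

Lemma le_tsum n F G : (forall r, size r = n -> F r <= G r) -> sum_hist n F <= sum_hist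
    n G.
Proof.
elim: n F G => [|n IH] F G h /=; first exact: h.
by apply: IH => r hr; apply: lerD; apply: h; rewrite /= hr.
Qed.

Lemma eq_tsum n F G : F =1 G -> sum_hist n F = sum_hist n G.
Proof. by move=> h; apply/eqP; rewrite eq_le !le_tsum // => r _; rewrite h. Qed.

Lemma sum_histD n F G : sum_hist n (fun r => F r + G r) = sum_hist n F + sum_hist n G.
Proof.
elim: n F G => [|n IH] F G //=; rewrite -IH; apply: eq_tsum => r; ring.
Qed.

Lemma sum_histZ n c F : sum_hist n (fun r => c * F r) = c * sum_hist n F.
Proof. by elim: n F => [|n IH] F //=; rewrite -IH; apply: eq_tsum => r; ring. Qed.

(** The hypothesis is the supermartingale inequality multiplied by [w r], so histories of weight
    zero need no conditional expectation. *)
Lemma sum_hist_supermartingale n (Phi : seq bool -> R) :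
  (forall r, w (true :: r) * Phi (true :: r) + w (false :: r) * Phi (false :: r)
     <= w r * Phi r) ->
  sum_hist n (fun r => w r * Phi r) <= Phi [::].
Proof.
move=> h; elim: n => [|n IH] /=; first by rewrite w_nil mul1r.
by apply: le_trans IH; apply: le_tsum => r _.
Qed.

Definition Pr n (B : seq bool -> bool) : R := sum_hist n (fun r => w r * (B r)%:R).

Lemma Pr_le n (B B' : seq bool -> bool) : (forall r, size r = n -> B r -> B' r) -> Pr n
    B <= Pr n B'.
Proof.
move=> h; apply: le_tsum => r hr; apply: ler_wpM2l => //.
by have := h r hr; case: (B r) => [->|]; rewrite ?ler0n.
Qed.

Lemma Pr_or n (B B' : seq bool -> bool) : Pr n (fun r => B r || B' r) <= Pr n B + Pr n B'.
Proof.
rewrite /Pr -sum_histD; apply: le_tsum => r _; rewrite -mulrDr; apply: ler_wpM2l => //.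
by case: (B r); case: (B' r); rewrite /= ?addr0 ?add0r // lerDl.
Qed.

Lemma Pr_true n : Pr n xpredT = 1.
Proof.
elim: n => [|n IH]; first by rewrite /Pr /= w_nil mulr1.
by rewrite -[RHS]IH /Pr /=; apply: eq_tsum => r; rewrite !mulr1 w_cons.
Qed.

Lemma Pr_hits_ge n f A q :
  Pr n (fun r => (A <= hits Q f r) && (trials Q f r <= q))%N * A%:R <= p * q%:R.
Proof.
(* On [trials <= q], hits plus p times the remaining trials is a martingale. *)
pose Phi r : R := if (trials Q f r <= q)%N then (hits Q f r)%:R + p * (q - trials Q f
    r)%:R else 0.
have Phi0 r : 0 <= Phi r.
  by rewrite /Phi; case: ifP => // _; rewrite addr_ge0 ?ler0n // mulr_ge0 ?ler0n ?ltW.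
have step r : w (true :: r) * Phi (true :: r) + w (false :: r) * Phi (false :: r) <= w
    r * Phi r.
  have [fr|nfr] := boolP (fresh Q r); last first.
    have E t : Phi (t :: r) = Phi r by rewrite /Phi /= (negbTE nfr) andbF.
    by rewrite !E -mulrDl w_cons.
  have wf : w (false :: r) = (1 - p) * w r by have := w_cons r; rewrite w_fresh //; lra.
  rewrite wf w_fresh //.
  have -> : forall a b, p * w r * a + (1 - p) * w r * b = w r * (p * a + (1 - p) * b)
      by move=> *; ring.
  apply: ler_wpM2l => //.
  (* A query beyond the budget [q] makes [Phi] zero after either answer. *)
  have [le|gt] := boolP (f r + trials Q f r <= q)%N; last first.
    by rewrite {1 2}/Phi /= fr (negbTE gt) !mulr0 addr0.
  have le' : (trials Q f r <= q)%N by lia.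
  rewrite /Phi /= fr le le' /= add0n natrD !natrB // natrD; lra.
rewrite mulrC /Pr -(sum_histZ n A%:R).
have -> : p * q%:R = Phi [::] by rewrite /Phi /= subn0 add0r.
apply: le_trans (sum_hist_supermartingale n Phi step).
apply: le_tsum => r _; rewrite mulrCA; apply: ler_wpM2l => //.
case: (boolP (_ && _)) => [/andP[h1 h2]|_]; last by rewrite mulr0.
rewrite mulr1 /Phi h2; have := h1; rewrite -(ler_nat R) => h.
by rewrite -[leLHS]addr0 lerD // mulr_ge0 ?ler0n ?ltW.
Qed.

(** * Chernoff bounds, with a union over a growing finite set of indices *)

Section UnionBound.

(** Outside the finite list [sup r] no index has had a trial; the list may depend on the queries but
    not on the latest answer. *)
Variables (I : eqType) (D : I -> seq bool -> bool) (sup : seq bool -> seq I).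
Hypothesis sup_uniq : forall r, uniq (sup r).
Hypothesis sup_tf : forall r, sup (true :: r) = sup (false :: r).
Hypothesis sup_mono : forall t r, {subset sup r <= sup (t :: r)}.
Hypothesis D_sup : forall x t r, D x r -> x \in sup (t :: r).

Lemma notin_sup x r : x \notin sup r -> hits Q (D x) r = 0%N /\ trials Q (D x) r = 0%N.
Proof.
elim: r => //= t r IH nx.
have /negbTE -> : ~~ D x r by apply: contra nx; apply: D_sup.
have [-> ->] := IH (contra (@sup_mono t r x) nx).
by do 2 case: ifP.
Qed.

Lemma Pr_some_hits_ge n k q (B z : R) : 1 < z ->
  (forall r, size r = n -> (size (sup r))%:R <= B) ->
  Pr n (fun r => has (fun x => (k <= hits Q (D x) r) && (trials Q (D x) r <= q))%N (sup
      r))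
    <= B * (z ^- k * (1 + (z - 1) * p) ^+ q).
Proof.
(* [rho] is the mean of [z] to the power of a [p]-biased bit, so dividing by it at each trial makes
   [phi x] a martingale. *)
move=> z1 hB; set rho := (1 + (z - 1) * p).
have rho1 : 1 < rho by rewrite /rho ltrDl mulr_gt0 ?subr_gt0.
have rho0 : 0 < rho by lra.
pose phi x r : R := z ^+ hits Q (D x) r * rho ^- trials Q (D x) r.
have phi0 x r : 0 <= phi x r by rewrite mulr_ge0 ?invr_ge0 ?exprn_ge0 //; lra.
have step x r : w (true :: r) * phi x (true :: r) + w (false :: r) * phi x (false :: r)
    = w r * phi x r.
  rewrite /phi /=; have [fr|nfr] := boolP (fresh Q r); last first.
    by rewrite /= !add0n -mulrDl w_cons.
  case: (D x r); rewrite /= ?add0n -?mulrDl ?w_cons // !add1n.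
  have wf : w (false :: r) = (1 - p) * w r by have := w_cons r; rewrite w_fresh //; lra.
  rewrite wf w_fresh // !exprS; set a := z ^+ _; set b := rho ^+ _.
  have b0 : b != 0 by rewrite expf_neq0 // gt_eqF.
  have -> : p * w r * (z * a * (rho * b)^-1) + (1 - p) * w r * (a * (rho * b)^-1)
    = w r * a * (rho * (rho * b)^-1) by rewrite /rho; ring.
  by rewrite invfM mulVKf ?gt_eqF // mulrA.
(* [phi x] is 1 until [x] enters [sup], so the sum over the growing list
   [sup r] of [phi x r - 1] is still a martingale. *)
pose Psi r := \sum_(x <- sup r) (phi x r - 1).
have sub r S : {subset sup r <= S} -> uniq S -> \sum_(x <- S) (phi x r - 1) = Psi r.
  move=> sS uS; rewrite (bigID (mem (sup r))) /= [X in _ + X]big1 ?addr0 => [|x nx];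
      last first.
    by rewrite /phi; have [-> ->] := notin_sup x r nx; rewrite !expr0 invr1 mulr1 subrr.
  rewrite -big_filter; apply: perm_big; apply: uniq_perm; rewrite ?filter_uniq //.
  by move=> x; rewrite mem_filter; apply: andb_idr; apply: sS.
have Pstep r : w (true :: r) * Psi (true :: r) + w (false :: r) * Psi (false :: r) <= w
    r * Psi r.
  rewrite -(sub r (sup (true :: r))) // {1 2}/Psi sup_tf !mulr_sumr -big_split.
  apply: ler_sum => x _ /=.
  rewrite !mulrBr addrACA step -opprD !mulr1 w_cons; lra.
have := sum_hist_supermartingale n Psi Pstep.
have -> : Psi [::] = 0.
  by rewrite /Psi big1 // => x _; rewrite /phi /= !expr0 invr1 mulr1 subrr.
move=> le0; set L := (z ^- k * rho ^+ q).
have L0 : 0 < L by rewrite mulr_gt0 ?invr_gt0 ?exprn_gt0 // (lt_trans ltr01).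
rewrite -ler_pdivrMr // mulrC -(sum_histZ n L^-1).
(* If some [x] meets both bounds then [phi x r] is at least [L^-1]; the sum of [phi] over [sup r] is
   [Psi r] plus the size of [sup r], at most [B]. *)
apply: (@le_trans _ _ (sum_hist n (fun r => w r * Psi r) + sum_hist n (fun r => B * (w
    r * true%:R)))); last first.
  by rewrite sum_histZ -/(Pr n xpredT) Pr_true mulr1; lra.
rewrite -sum_histD; apply: le_tsum => r hr; rewrite mulr1 mulrCA [B * _]mulrC -mulrDr.
apply: ler_wpM2l => //.
apply: (@le_trans _ _ (\sum_(x <- sup r) phi x r)); last first.
  rewrite /Psi big_split /= big_const_seq count_predT iter_addr_0.
  have := hB r hr; rewrite mulNrn; lra.
case: hasP => [[x xs /andP[h1 h2]]|_]; last by rewrite mulr0 sumr_ge0.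
rewrite mulr1 (big_rem x) //= -[leLHS]addr0 lerD ?sumr_ge0 //.
rewrite /L /phi invfM invrK ler_pM ?invr_ge0 ?exprn_ge0 ?ler_weXn2l //; try lra.
by rewrite lef_pV2 ?posrE ?exprn_gt0 // ler_weXn2l //; lra.
Qed.

End UnionBound.
End Martingale.

(** * Law of the answers given by the random graph *)

Section AnswerLaw.

Variables (d : measure_display) (T : measurableType d) (R : realType)
  (P : probability T R) (p : R) (G : T -> rel nat) (S : strategy).
Hypothesis GP : erdos_renyi P p G.

Definition next (r : seq bool) : nat * nat := S (rev r).

Definition history (r : seq bool) : set T :=
  [set o | answers S (G o) (size r) = rev r].

Definition prob (X : set T) : R := fine (P X).

Definition weight (r : seq bool) : R := prob (history r).

Definition edge_is (e : nat * nat) (b : bool) : set T := [set o | G o e.1 e.2 = b].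

Definition all_edges (s : seq (nat * nat)) : set T :=
  [set o | forall e, e \in s -> G o e.1 e.2].

Lemma measurable_edge_is e b : measurable (edge_is e b).
Proof.
case: b; first exact: (er_measurable GP).
rewrite (_ : edge_is e false = ~` edge_is e true);
    first exact/measurableC/(er_measurable GP).
by apply/seteqP; split=> o; rewrite /edge_is /=; case: (G o _ _).
Qed.
Hint Resolve measurable_edge_is : core.

Lemma all_edges_cons e s : all_edges (e :: s) = edge_is e true `&` all_edges s.
Proof.
apply/seteqP; split=> o /=.
  move=> h; split; first by apply: h; rewrite mem_head.
  by move=> e' h'; apply: h; rewrite inE h' orbT.
by move=> [h1 h2] e'; rewrite inE => /orP[/eqP->|/h2].
Qed.

Lemma measurable_all_edges s : measurable (all_edges s).
Proof.
elim: s => [|e s IH]; last by rewrite all_edges_cons; apply: measurableI.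
by rewrite (_ : all_edges [::] = setT) //; apply/seteqP; split.
Qed.
Hint Resolve measurable_all_edges : core.

Lemma history_cons b r : history (b :: r) = history r `&` edge_is (next r) b.
Proof.
apply/seteqP; split=> o; rewrite /history /edge_is /next /= rev_cons.
  by move=> /rcons_inj[<- <-].
by move=> [-> ->].
Qed.

Lemma measurable_history r : measurable (history r).
Proof.
elim: r => [|b r IH]; last by rewrite history_cons; apply: measurableI.
by rewrite (_ : history [::] = setT) //; apply/seteqP; split.
Qed.
Hint Resolve measurable_history : core.

Lemma prob_ge0 X : 0 <= prob X.
Proof. exact/fine_ge0. Qed.

Lemma prob_edgeU X e : measurable X ->
  prob (X `&` edge_is e true) + prob (X `&` edge_is e false) = prob X.
Proof.
move=> mX; rewrite /prob -fineD ?fin_num_measure //; try exact: measurableI.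
rewrite -measureU; [|exact: measurableI|exact: measurableI|]; last first.
  by apply/seteqP; split=> // o [[_ h1] [_]]; rewrite /edge_is /= h1.
congr (fine (P _)); apply/seteqP; split=> o; first by case=> -[].
by move=> Xo; case E: (G o e.1 e.2); [left|right].
Qed.

Lemma asked_determined r e : e \in asked next r ->
  exists b, history r `<=` edge_is e b.
Proof.
elim: r => //= b r IH; rewrite in_cons history_cons => /orP[/eqP->|/IH[b' h]].
  by exists b => o [].
by exists b' => o [/h].
Qed.

Lemma edge_isC u v b : edge_is (u, v) b = edge_is (v, u) b.
Proof. by apply/seteqP; split=> o; rewrite /edge_is /= (er_sym GP). Qed.

Lemma stale_determined r : ~~ fresh next r ->
  exists b, history r `<=` edge_is (next r) b.
Proof.
rewrite /fresh !negb_and !negbK => /or3P[/eqP e|/asked_determined//|/asked_determined[b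
    h]].
  by exists false => o _; rewrite /edge_is /= e (er_irrefl GP).
by exists b => o /h; rewrite /swap edge_isC -surjective_pairing.
Qed.

Lemma prob_all_edges s : uniq s -> all (fun e => e.1 < e.2)%N s ->
  prob (all_edges s) = p ^+ size s.
Proof.
move=> us ls; rewrite /prob (er_indep GP) //.
rewrite (_ : (\prod_(e <- s) _)%E = (p ^+ size s)%:E) //.
elim: s ls {us} => [|e s IH] /=; first by rewrite big_nil.
move=> /andP[l /IH {}IH]; rewrite big_cons IH (er_prob GP) ?neq_ltn ?l //.
by rewrite -EFinM exprS.
Qed.

(** Pairs not yet queried stay independent of the history. The product rule concerns present edges
    only, so a positive answer is absorbed into [s] and a negative one is handled by complement;
    hence the induction over all [s]. *)
Lemma prob_history_all_edges r s : uniq s -> all (fun e => e.1 < e.2)%N s ->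
  (forall e, e \in s -> (e \notin asked next r) && (swap e \notin asked next r)) ->
  prob (history r `&` all_edges s) = p ^+ size s * weight r.
Proof.
elim: r s => [|b r IH] s us ls fs.
  have h0 : history [::] = setT by apply/seteqP; split.
  by rewrite /weight h0 setTI prob_all_edges // /prob probability_setT mulr1.
have fs' e : e \in s -> (e \notin asked next r) && (swap e \notin asked next r).
  by move=> /fs /=; rewrite !in_cons !negb_or => /andP[/andP[_ ->] /andP[_ ->]].
(* The answer to a stale query is predetermined, so the longer history is the old event or empty. *)
have [fr|/stale_determined[b' h]] := boolP (fresh next r); last first.
  rewrite /weight history_cons; have [<-|nb] := eqVneq b' b.
    by rewrite (setIidl h) -/(weight r) IH.
  rewrite (_ : history r `&` edge_is (next r) b = set0) ?set0I;
      first by rewrite /prob measure0 mulr0.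
  by apply/seteqP; split=> // o [/h /= hb hb']; move/eqP: nb; rewrite -hb -hb'.
(* The fresh query, oriented increasingly, can join the independent family [s]. *)
have [e0 [E0 lt0 n0 m0 ne0]] : exists e0, [/\ forall b, edge_is e0 b = edge_is (next r) b,
    (e0.1 < e0.2)%N, e0 \notin asked next r, swap e0 \notin asked next r & e0 \notin s].
  have nxt : next r \notin s /\ swap (next r) \notin s.
    split; apply/negP => /fs /=; rewrite !in_cons ?eqxx //.
    by rewrite /swap -surjective_pairing eqxx /= andbF.
  case/and3P: fr; case E: (next r) nxt => [u v] /= [ns ns'].
  rewrite neq_ltn => /orP[lt|lt] nq nq'; first by exists (u, v).
  by exists (v, u); split => // c; rewrite edge_isC.
have IH1 : prob (history r `&` all_edges (e0 :: s)) = p ^+ (size s).+1 * weight r.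
  apply: IH; rewrite /= ?us ?ls ?lt0 ?ne0 //.
  by move=> e; rewrite in_cons => /orP[/eqP->|/fs']; rewrite ?n0 ?m0.
have IH2 : prob (history r `&` edge_is e0 true) = p * weight r.
  have := IH [:: e0]; rewrite all_edges_cons (_ : all_edges [::] = setT);
      last by apply/seteqP; split.
  rewrite setIT expr1; apply => //=; first by rewrite lt0.
  by move=> e; rewrite inE => /eqP->; rewrite n0 m0.
have IH3 := IH s us ls fs'.
have tr : prob (history (true :: r) `&` all_edges s) = p ^+ (size s).+1 * weight r.
  by rewrite history_cons -E0 -setIA -all_edges_cons IH1.
have wt : weight (true :: r) = p * weight r by rewrite /weight history_cons -E0 IH2.
case: b {fs}; first by rewrite tr wt exprSr mulrA.
have wf : weight (false :: r) = (1 - p) * weight r.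
  have := prob_edgeU (history r) (next r) (measurable_history r).
  rewrite -!history_cons -/(weight (true :: r)) -/(weight (false :: r)) -/(weight r)
      wt; lra.
rewrite wf.
have := prob_edgeU (history r `&` all_edges s) (next r).
rewrite IH3 => /(_ (measurableI _ _ (measurable_history r) (measurable_all_edges s))).
rewrite ![_ `&` all_edges s `&` _]setIAC -!history_cons tr exprS => h.
by rewrite mulrCA mulrBl mul1r; lra.
Qed.

Lemma weight_nil : weight [::] = 1.
Proof.
by rewrite /weight /prob (_ : history _ = setT) ?probability_setT //; apply/seteqP; split.
Qed.

Lemma weight_cons r : weight (true :: r) + weight (false :: r) = weight r.
Proof. by rewrite /weight !history_cons prob_edgeU. Qed.

Lemma weight_fresh r : fresh next r -> weight (true :: r) = p * weight r.
Proof.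
move=> fr; have [n1 n2 n3] := and3P fr.
pose e0 := if ((next r).1 < (next r).2)%N then next r else swap (next r).
have E0 : edge_is e0 true = edge_is (next r) true.
  by rewrite /e0; case: ifP => // _; rewrite /swap edge_isC -surjective_pairing.
have := prob_history_all_edges r [:: e0].
rewrite all_edges_cons (_ : all_edges [::] = setT); last by apply/seteqP; split.
rewrite setIT expr1 E0 -history_cons; apply => //=.
  by rewrite /e0 andbT; case: ifP => // /negbT;
      rewrite -leqNgt leq_eqVlt eq_sym (negbTE n1).
move=> e; rewrite inE => /eqP->; rewrite /e0; case: ifP => _; first by rewrite n2 n3.
by rewrite swapK n2 n3.
Qed.

Definition after_query (X : seq bool -> set T) r : set T :=
  (edge_is (next r) true `&` X (true :: r)) `|`
  (edge_is (next r) false `&` X (false :: r)).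

Lemma measurable_after_query X r : (forall r, measurable (X r)) ->
  measurable (after_query X r).
Proof. by move=> mX; apply: measurableU; apply: measurableI. Qed.

Lemma answersS n X : [set o | X (rev (answers S (G o) n.+1)) o] =
  [set o | after_query X (rev (answers S (G o) n)) o].
Proof.
apply/seteqP; split=> o /=; rewrite rev_rcons /after_query /edge_is /next /= revK;
  case: (G o _ _) => //=; by [left|right|case=> -[]].
Qed.

Lemma measurable_answers n (X : seq bool -> set T) : (forall r, measurable (X r)) ->
  measurable [set o | X (rev (answers S (G o) n)) o].
Proof.
elim: n X => [|n IH] X mX; first exact: mX.
by rewrite answersS; apply: IH => r; apply: measurable_after_query.
Qed.

(** Total probability over the histories of length [n]; [after_query] pulls an event back by one
    query, which is the induction step. *)
Lemma prob_answers n (X : seq bool -> set T) : (forall r, measurable (X r)) ->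
  prob [set o | X (rev (answers S (G o) n)) o] = sum_hist R n (fun r => prob (history r
      `&` X r)).
Proof.
elim: n X => [|n IH] X mX.
  by rewrite /=; congr prob; apply/seteqP; split=> o //= [].
rewrite answersS IH => [|r]; last exact: measurable_after_query.
apply: eq_tsum => r.
have mY b : measurable (history r `&` edge_is (next r) b `&` X (b :: r)) by do 2 apply:
    measurableI => //.
rewrite !history_cons /prob -fineD ?fin_num_measure // -measureU //.
  by congr (fine (P _)); rewrite /after_query setIUr !setIA.
by apply/seteqP; split=> // o [[[_ h1] _] [[_ +]]]; rewrite /edge_is /= h1.
Qed.

Lemma mem_queries o n e :
  (e \in queries S (G o) n) = (e \in asked next (rev (answers S (G o) n))).
Proof.
elim: n => // n IH; rewrite /queries -addn1 iotaD map_cat mem_cat -/(queries _ _ _) IH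
    addn1 /=.
by rewrite rev_rcons /= !in_cons orbF /next revK orbC.
Qed.

(** Ignoring stale queries loses nothing: a repeated query was recorded when first asked, and a loop
    is never an edge. *)
Lemma adj_answers o n u v : adj next (rev (answers S (G o) n)) u v =
  G o u v && (((u, v) \in queries S (G o) n) || ((v, u) \in queries S (G o) n)).
Proof.
rewrite !mem_queries; elim: n => [|n IH]; first by rewrite andbF.
rewrite [answers _ _ _]/= rev_rcons adj_cons IH /= !in_cons /next revK.
set r := rev _; set e := S _.
have ->: asks next r u v = (((u, v) == e) || ((v, u) == e)).
  by rewrite /asks /next revK -/e ![e == _]eq_sym.
have [fr|nf] := boolP (fresh next r).
  rewrite andbT; apply/idP/idP.
    move=> /orP[/andP[-> /orP[]->]|/andP[g /orP[]/eqP h]]; rewrite ?orbT //.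
    - by move: g; rewrite -h /= => ->; rewrite eqxx.
    - by move: g; rewrite -h /= (er_sym GP) => ->; rewrite eqxx orbT.
  move=> /andP[g /orP[]/orP[/eqP h|h]]; rewrite ?g ?h ?orbT //.
    by rewrite -h /= g eqxx orbT.
  by rewrite -h /= (er_sym GP) g eqxx !orbT.
rewrite andbF orbF; case g: (G o u v) => //=.
have key : forall a b, (a, b) = e -> G o a b ->
    ((a, b) \in asked next r) || ((b, a) \in asked next r).
  move=> a b h gab; have Qe : next r = (a, b) by rewrite /next revK -/e h.
  move: nf; rewrite /fresh Qe /swap /= !negb_and !negbK.
  by move=> /or3P[/eqP ab|->|->]; rewrite ?orbT //; rewrite ab (er_irrefl GP) in gab.
apply/idP/idP => [/orP[]->|]; rewrite ?orbT //.
move=> /orP[]/orP[/eqP h|->]; rewrite ?orbT //; first exact: key.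
by rewrite orbC; apply: key => //; rewrite (er_sym GP).
Qed.

Lemma finds_prob n : P [set o | finds triforce (G o) S n] =
  (Pr R weight n (fun r => `[< found next r >]))%:E.
Proof.
pose X r : set T := if `[< found next r >] then setT else set0.
have mX r : measurable (X r) by rewrite /X; case: ifP.
have E : [set o | finds triforce (G o) S n] = [set o | X (rev (answers S (G o) n)) o].
  apply/seteqP; split=> o /=; rewrite /X.
    move=> [phi inj h]; rewrite asboolT //; exists phi => // x y /h[h1 h2].
    by rewrite adj_answers h1 h2.
  case: asboolP => // -[phi inj h] _; exists phi => // x y /h.
  by rewrite adj_answers => /andP.
have mE : measurable [set o | finds triforce (G o) S n].
  by rewrite E; apply: measurable_answers.
rewrite -(fineK (fin_num_measure P _ mE)); congr (_%:E).
rewrite -/(prob _) E prob_answers // /Pr; apply: eq_tsum => r; rewrite /X.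
by case: ifP; rewrite ?setIT ?setI0 ?mulr1 // /prob measure0 mulr0.
Qed.

End AnswerLaw.

(** * Reduction of success to five unlikely events *)

Section FoundBound.

Variable Q : seq bool -> nat * nat.

(** Index set of the union bounds: an untouched vertex has had no hits or trials, so at most [2 * n]
    vertices matter after [n] queries. *)
Definition touched (r : seq bool) : seq nat :=
  undup (unzip1 (asked Q r) ++ unzip2 (asked Q r)).

Definition touched_pairs r : seq (nat * nat) :=
  [seq (u, v) | u <- touched r, v <- touched r].

Lemma size_touched r : (size (touched r) <= 2 * size r)%N.
Proof.
apply: leq_trans (size_undup _) _; rewrite size_cat !size_map addnn -mul2n leq_mul2l /=.
by elim: r => //= t r; rewrite ltnS.
Qed.

Lemma size_touched_pairs r : (size (touched_pairs r) <= (2 * size r) ^ 2)%N.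
Proof. by rewrite size_allpairs leq_mul ?size_touched. Qed.

Lemma touched_pairs_uniq r : uniq (touched_pairs r).
Proof. by apply: allpairs_uniq => [||[a b] [c d]]; rewrite ?undup_uniq. Qed.

Lemma touched_mono t r : {subset touched r <= touched (t :: r)}.
Proof.
move=> x; rewrite !mem_undup !mem_cat /= !in_cons => /orP[]->; rewrite !orbT //.
Qed.

Lemma mem_touched_pairs r u v :
  ((u, v) \in touched_pairs r) = (u \in touched r) && (v \in touched r).
Proof.
apply/allpairsP/andP => [[[a b] [ha hb [-> ->]]]//|[hu hv]]; by exists (u, v).
Qed.

Lemma touched_pairs_mono t r : {subset touched_pairs r <= touched_pairs (t :: r)}.
Proof.
by move=> [u v]; rewrite !mem_touched_pairs => /andP[hu hv]; rewrite !touched_mono.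
Qed.

Lemma adj_touched r u v : adj Q r u v -> u \in touched r.
Proof.
rewrite mem_undup mem_cat => /arcs_asked/orP[] h; apply/orP; [left|right];
  by apply/mapP; eexists; first exact: h.
Qed.

Lemma asks_touched t r u v : asks Q r u v -> u \in touched (t :: r).
Proof.
by rewrite mem_undup mem_cat /= !in_cons /asks => /orP[]/eqP->; rewrite /= eqxx ?orbT.
Qed.

Lemma cherry_touched x t r : closes_cherry Q x.1 x.2 r -> x \in touched_pairs (t :: r).
Proof.
case: x => u v /asboolP[y [[q a]|[q a]]]; rewrite mem_touched_pairs
  (asks_touched t _ _ _ q) (touched_mono t _ _ (adj_touched _ _ _ a)) //.
Qed.

Lemma near_touched b t r : closes_near Q b r -> b \in touched (t :: r).
Proof.
move=> /asboolP[x [y [w [q _ _ _ [<-|a]]]]]; first exact: asks_touched q.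
exact/touched_mono/(adj_touched _ _ _ a).
Qed.

Lemma trials1_le r : (trials Q (fun=> 1) r <= size r)%N.
Proof. by elim: r => //= t r IH; case: ifP => _; lia. Qed.

(** Excluding in turn too many edges, large codegrees, many tips and many closed paths bounds the
    trials of the later events, until a found triforce forces the fifth. One budget [q] serves
    codegrees and tips. *)
Lemma found_bad n M k q A r : size r = n -> (8 * M * k.+1 <= q)%N -> found Q r ->
  [|| ((M.+1 <= hits Q (fun=> 1) r) && (trials Q (fun=> 1) r <= n))%N,
      has (fun x => (k <= hits Q (closes_cherry Q x.1 x.2) r)
        && (trials Q (closes_cherry Q x.1 x.2) r <= q))%N (touched_pairs r),
      has (fun b => (k <= hits Q (closes_near Q b) r)
        && (trials Q (closes_near Q b) r <= q))%N (touched r),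
      ((A <= hits Q (fun r => size (paths3 Q r)) r)
        && (trials Q (fun r => size (paths3 Q r)) r <= (2 * M) ^ 2))%N |
      ((1 <= hits Q (closes_triforce Q) r)
        && (trials Q (closes_triforce Q) r <= 2 * (4 * A + 2 * M * (k * (2 * k.+1)))))%N].
Proof.
move=> rn hq /found_hit F.
case: leqP => [M1|_]; last by rewrite -rn trials1_le.
rewrite /=.
case: (boolP (has _ (touched_pairs r))) => [//|/hasPn n2]; rewrite /=.
have cod : codeg_le Q k r.
  move=> u v uv; apply: leq_trans (codeg_hits Q u v r uv) _.
  case: (boolP ((u, v) \in touched_pairs r)) => [/n2 /=|/(notin_sup Q _ (fun x =>
      closes_cherry Q x.1 x.2) _)].
    rewrite negb_and -!ltnNge => /orP[/ltnW//|].
    by have := codeg_count Q u v r => /=; nia.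
  by case/(_ touched_pairs_mono cherry_touched) => -> _.
case: (boolP (has _ (touched r))) => [//|/hasPn n3]; rewrite ?orbT //=.
have tp b : (size (tips Q r b) <= k * (2 * k.+1))%N.
  apply: leq_trans (size_tips Q k b r cod) _; rewrite leq_mul2r orbC.
  case: (boolP (b \in touched r)) => [/n3 /=|/(notin_sup Q _ (closes_near Q) _)].
    rewrite negb_and -!ltnNge => /orP[/ltnW->//|].
    by have := near_count Q k b r cod; nia.
  by case/(_ touched_mono near_touched) => -> _.
case: (leqP A) => [_|X4] /=.
  by apply/orP; left; apply: leq_trans (paths3_count Q r) _;
      rewrite leq_exp2r // leq_mul2l.
rewrite F /=; apply: leq_trans (closes_triforce_count Q _ r tp) _.
nia.
Qed.

End FoundBound.

Lemma Pr_found_le (R : realType) (Q : seq bool -> nat * nat) (p : R) (w : seq bool -> R)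
    (n M k q A : nat) (z : R) :
  0 < p -> w [::] = 1 -> (forall r, 0 <= w r) ->
  (forall r, w (true :: r) + w (false :: r) = w r) ->
  (forall r, fresh Q r -> w (true :: r) = p * w r) ->
  1 < z -> (0 < A)%N -> (8 * M * k.+1 <= q)%N ->
  Pr R w n (fun r => `[< found Q r >]) <=
    p * n%:R / M.+1%:R + 6 * n%:R ^+ 2 * (z ^- k * (1 + (z - 1) * p) ^+ q)
    + p * (2 * M%:R) ^+ 2 / A%:R
    + p * (2 * (4 * A%:R + 2 * M%:R * (k%:R * (2 * k.+1%:R)))).
Proof.
move=> p0 w1 w0 wc wf z1 A0 hq; set E := z ^- k * _.
pose B1 r := (M.+1 <= hits Q (fun=> 1) r)%N && (trials Q (fun=> 1) r <= n)%N.
pose B2 r := has (fun x => (k <= hits Q (closes_cherry Q x.1 x.2) r)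
        && (trials Q (closes_cherry Q x.1 x.2) r <= q))%N (touched_pairs Q r).
pose B3 r := has (fun b => (k <= hits Q (closes_near Q b) r)
        && (trials Q (closes_near Q b) r <= q))%N (touched Q r).
pose B4 r := (A <= hits Q (fun r => size (paths3 Q r)) r)%N
        && (trials Q (fun r => size (paths3 Q r)) r <= (2 * M) ^ 2)%N.
pose B5 r := (1 <= hits Q (closes_triforce Q) r)%N
        && (trials Q (closes_triforce Q) r <= 2 * (4 * A + 2 * M * (k * (2 * k.+1))))%N.
have E0 : 0 <= E.
  rewrite mulr_ge0 ?invr_ge0 ?exprn_ge0 //; first lra.
  by rewrite addr_ge0 // mulr_ge0 ?ltW // subr_gt0.
apply: (@le_trans _ _ (Pr R w n (fun r => [|| B1 r, B2 r, B3 r, B4 r | B5 r]))).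
  by apply: Pr_le => // r rn /asboolP; apply: found_bad.
have h1 : Pr R w n B1 <= p * n%:R / M.+1%:R.
  by rewrite ler_pdivlMr ?ltr0n //; apply: Pr_hits_ge.
have h2 : Pr R w n B2 <= 4 * n%:R ^+ 2 * E.
  apply: Pr_some_hits_ge => //.
  - exact: touched_pairs_uniq.
  - exact: touched_pairs_mono.
  - exact: cherry_touched.
  - move=> r <-; rewrite -natrX -natrM ler_nat.
    by apply: leq_trans (size_touched_pairs Q r) _; rewrite expnMn.
have h3 : Pr R w n B3 <= 2 * n%:R * E.
  apply: Pr_some_hits_ge => //.
  - by move=> r; apply: undup_uniq.
  - exact: touched_mono.
  - exact: near_touched.
  - by move=> r <-; rewrite -natrM ler_nat size_touched.
have h4 : Pr R w n B4 <= p * (2 * M%:R) ^+ 2 / A%:R.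
  by rewrite ler_pdivlMr ?ltr0n // -natrM -natrX; apply: Pr_hits_ge.
have h5 : Pr R w n B5 <= p * (2 * (4 * A%:R + 2 * M%:R * (k%:R * (2 * k.+1%:R)))).
  have := Pr_hits_ge R Q p w p0 w1 w0 wc wf n (closes_triforce Q) 1 (2 * (4 * A + 2 * M
      * (k * (2 * k.+1)))).
  by rewrite mulr1 !(natrM, natrD).
(* The [4 * n ^ 2] pairs and [2 * n] vertices together give the factor 6. *)
have nn : n%:R <= n%:R ^+ 2 :> R by rewrite -natrX ler_nat; case: (n) => // m;
    rewrite expnS expn1 leq_pmulr.
have nE : n%:R * E <= n%:R ^+ 2 * E by apply: ler_wpM2r.
have or_le B B' b b' : Pr R w n B <= b -> Pr R w n B' <= b' ->
    Pr R w n (fun r => B r || B' r) <= b + b'.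
  by move=> hb hb'; apply: le_trans (Pr_or R w w0 n B B') (lerD hb hb').
have := or_le _ _ _ _ h1 (or_le _ _ _ _ h2 (or_le _ _ _ _ h3 (or_le _ _ _ _ h4 h5))).
move/le_trans; apply; rewrite !addrA 2!lerD2r -[leLHS]addrA lerD2l.
by move: nE; rewrite -!mulrA; lra.
Qed.

(** * Choice of parameters and asymptotics *)

Lemma Pr_found_lt_half (R : realType) (Q : seq bool -> nat * nat) (p l : R)
    (w : seq bool -> R) (n : nat) :
  0 < p -> p <= 1000^-1 -> p * expR 1 <= 1 -> 1000 <= l ->
  (forall k, 24 * l <= k%:R -> l ^- k <= p ^+ 6) ->
  n%:R * (p ^+ 2 * l ^+ 4) <= 1 ->
  w [::] = 1 -> (forall r, 0 <= w r) ->
  (forall r, w (true :: r) + w (false :: r) = w r) ->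
  (forall r, fresh Q r -> w (true :: r) = p * w r) ->
  Pr R w n (fun r => `[< found Q r >]) < 2^-1.
Proof.
move=> p0 p1 pe l1 decay hn w1 w0 wc wf.
have l0 : 0 < l by lra.
have lB : 0 <= l - 1 by lra.
have z1 : 1 < l by lra.
have p0' := ltW p0; have l0' := ltW l0.
have base0 : 0 <= 1 + (l - 1) * p by rewrite addr_ge0 ?mulr_ge0.
have l2 : 1000 * 1000 <= l ^+ 2 by rewrite expr2; apply: ler_pM; rewrite ?ler0n.
(* [M.+1] exceeds [20 * p * n] and [A] exceeds 20 times [p * (2 * M) ^ 2], so both Markov bounds
   give 1/20; [k] is just large enough for [decay]. *)
pose M := Num.truncn (20 * (p * n%:R)).
pose k := (Num.truncn (24 * l)).+1.
pose A := (Num.truncn (80 * (p * M%:R ^+ 2))).+1.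
pose q := (8 * M * k.+1)%N.
have pn0 : 0 <= p * n%:R by rewrite mulr_ge0.
have [M1 M2] : M%:R <= 20 * (p * n%:R) /\ 20 * (p * n%:R) < M.+1%:R.
  by apply/andP/truncn_itv; rewrite mulr_ge0.
have [k1 k2] : 24 * l <= k%:R /\ k%:R <= 25 * l.
  have /truncn_itv/andP[h1 h2] : 0 <= 24 * l by rewrite mulr_ge0.
  split; first exact: ltW.
  by rewrite /k -natr1; move: h1 z1; clear; lra.
have [A1 A2] : 80 * (p * M%:R ^+ 2) < A%:R /\ A%:R <= 80 * (p * M%:R ^+ 2) + 1.
  have /truncn_itv/andP[h1 h2] : 0 <= 80 * (p * M%:R ^+ 2) by rewrite !mulr_ge0
      ?exprn_ge0.
  by split; rewrite /A // -natr1 lerD2r.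
pose m := p * M%:R.
have m0 : 0 <= m by rewrite mulr_ge0.
(* Since [p * M <= 20 * p ^ 2 * n], the bound on [n] makes [p * M] of order [l ^- 4]. *)
have ml4 : m * l ^+ 4 <= 20.
  apply: (@le_trans _ _ (20 * (n%:R * (p ^+ 2 * l ^+ 4))));
      last by rewrite -[leRHS]mulr1 ler_pM2l.
  have -> : 20 * (n%:R * (p ^+ 2 * l ^+ 4)) = p * (20 * (p * n%:R)) * l ^+ 4 by ring.
  by rewrite ler_pM2r ?exprn_gt0 // ler_pM2l.
have ml2 : m * l ^+ 2 * 1000 * 20 <= 1.
  have y0 : 0 <= m * l ^+ 2 by rewrite mulr_ge0 ?exprn_ge0.
  have : m * l ^+ 2 * (1000 * 1000) <= m * l ^+ 2 * l ^+ 2 by apply: ler_wpM2l.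
  have -> : m * l ^+ 2 * l ^+ 2 = m * l ^+ 4 by ring.
  by move: ml4 y0; clear; lra.
have m1 : m * 1000 * 20 <= 1.
  have : m * 1 <= m * l ^+ 2 by apply: ler_wpM2l => //; rewrite exprn_ege1 // ltW.
  by move: ml2; clear; lra.
have kl : k.+1%:R <= 26 * l by rewrite -natr1; move: k2 z1; clear; lra.
have kk : k%:R * (2 * k.+1%:R) <= 1300 * l ^+ 2.
  apply: (@le_trans _ _ (25 * l * (2 * (26 * l)))).
    by apply: ler_pM => //; rewrite ler_pM2l.
  by rewrite expr2; clear; lra.
have T5 : p * (2 * (4 * A%:R + 2 * M%:R * (k%:R * (2 * k.+1%:R)))) <= 3 / 10.
  have -> : p * (2 * (4 * A%:R + 2 * M%:R * (k%:R * (2 * k.+1%:R)))) =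
    8 * (p * A%:R) + 4 * (m * (k%:R * (2 * k.+1%:R))) by rewrite /m; ring.
  have h1 : m * (k%:R * (2 * k.+1%:R)) <= m * (1300 * l ^+ 2) by apply: ler_wpM2l.
  have h2 : p * A%:R <= 80 * m ^+ 2 + p.
    have -> : 80 * m ^+ 2 + p = p * (80 * (p * M%:R ^+ 2) + 1) by rewrite /m; ring.
    by rewrite ler_pM2l.
  have h3 : m ^+ 2 <= m.
    rewrite expr2 -[leRHS]mulr1; apply: ler_wpM2l => //.
    by move: m1; clear; lra.
  by move: h1 h2 h3 ml2 m1 p1; clear; lra.
have T1 : p * n%:R / M.+1%:R <= 1 / 20.
  by rewrite ler_pdivrMr ?ltr0n //; move: M2; clear; lra.
have T4 : p * (2 * M%:R) ^+ 2 / A%:R <= 1 / 20.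
  rewrite ler_pdivrMr ?ltr0n //.
  have -> : p * (2 * M%:R) ^+ 2 = 4 * (p * M%:R ^+ 2) by ring.
  by move: A1; clear; lra.
(* The exponent [8 * m * k.+1 * (l - 1)] is at most [208 * m * l ^ 2], below 1. *)
have E1 : (1 + (l - 1) * p) ^+ q <= expR 1.
  apply: (@le_trans _ _ (expR ((l - 1) * p) ^+ q)).
    by apply: lerXn2r; rewrite ?nnegrE ?expR_ge0 ?expR_ge1Dx.
  rewrite -expRM_natl ler_expR /q !natrM.
  have -> : 8 * M%:R * k.+1%:R * ((l - 1) * p) = 8 * (m * (k.+1%:R * (l - 1))) by
      rewrite /m; ring.
  have : m * (k.+1%:R * (l - 1)) <= m * (26 * l * l).
    by apply: ler_wpM2l => //; apply: ler_pM => //; rewrite lerBlDr lerDl.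
  have -> : m * (26 * l * l) = 26 * (m * l ^+ 2) by ring.
  by move: ml2; clear; lra.
have E2 : l ^- k * (1 + (l - 1) * p) ^+ q <= p ^+ 5.
  apply: (@le_trans _ _ (p ^+ 6 * expR 1)).
    by apply: ler_pM; rewrite ?invr_ge0 ?exprn_ge0 ?decay.
  by rewrite exprSr -mulrA -[leRHS]mulr1 ler_pM2l ?exprn_gt0.
(* Of the six powers of [p] from [decay], one has paid for [expR 1], four pay for [n ^ 2], and one
   remains small. *)
have T2 : 6 * n%:R ^+ 2 * (l ^- k * (1 + (l - 1) * p) ^+ q) <= 6 / 1000.
  have np0 : 0 <= n%:R * p ^+ 2 by rewrite mulr_ge0 ?exprn_ge0.
  have np : n%:R * p ^+ 2 <= 1.
    apply: le_trans hn; rewrite mulrA -[leLHS]mulr1; apply: ler_wpM2l => //.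
    by rewrite exprn_ege1 // ltW.
  apply: (@le_trans _ _ (6 * n%:R ^+ 2 * p ^+ 5)).
    by apply: ler_wpM2l => //; rewrite mulr_ge0 ?exprn_ge0.
  have -> : 6 * n%:R ^+ 2 * p ^+ 5 = 6 * ((n%:R * p ^+ 2) ^+ 2 * p) by ring.
  have : (n%:R * p ^+ 2) ^+ 2 * p <= 1 * p by apply: ler_wpM2r => //; rewrite expr_le1.
  by move: p1; clear; lra.
apply: le_lt_trans (@Pr_found_le R Q p w n M k q A l p0 w1 w0 wc wf z1 isT (leqnn _)) _.
apply: le_lt_trans (lerD (lerD (lerD T1 T2) T4) T5) _.
by clear; lra.
Qed.

(** Let [L] be log(1/p), [u] be log L and [l = L / (2 * u)]. Then [l ^ 2 >= L], so [l] to the power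
    [-24 * l] is at most [expR (- 12 * l * u) = expR (- 6 * L) = p ^ 6], whence the 24. *)
Lemma large_ell (R : realType) (p : R) : 0 < p -> p < expR (- expR 80) ->
  [/\ p <= 1000^-1, p * expR 1 <= 1, 1000 <= ell p &
   forall k, 24 * ell p <= k%:R -> ell p ^- k <= p ^+ 6].
Proof.
move=> p0 hp; rewrite /ell.
have pL : p = expR (- ln p^-1) by rewrite lnV ?posrE // opprK lnK.
move: (ln p^-1) pL hp => L -> {p p0}; rewrite ltr_expR ltrN2 => L80.
have L0 : 0 < L := lt_trans (expR_gt0 _) L80.
have u80 : 80 <= ln L by rewrite -[leLHS]expRK ler_ln ?posrE ?expR_gt0 // ltW.
have Lu : L = expR (ln L) by rewrite lnK.
move: (ln L) u80 Lu {L80} => u u80 Lu.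
have u4 : u ^+ 4 <= 256 * L.
  have -> : L = expR (u / 4) ^+ 4.
    by rewrite -expRM_natl Lu; congr expR; rewrite mulrC divfK.
  have -> : 256 * expR (u / 4) ^+ 4 = (4 * expR (u / 4)) ^+ 4 by ring.
  apply: lerXn2r; rewrite ?nnegrE ?mulr_ge0 ?expR_ge0 //; first by move: u80; clear; lra.
  by have := expR_ge1Dx (u / 4); clear; lra.
have u0 : 0 <= u by apply: le_trans u80.
have u2 : 80 * 80 <= u ^+ 2 by rewrite expr2; apply: ler_pM.
have u2u : 80 * u <= u ^+ 2 by rewrite expr2; apply: ler_wpM2r.
have e4 : u ^+ 4 = u ^+ 2 * u ^+ 2 by ring.
have L1 : 4 * u ^+ 2 <= L.
  have : 80 * 80 * u ^+ 2 <= u ^+ 2 * u ^+ 2 by apply: ler_wpM2r => //; rewrite exprn_ge0.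
  by move: u4 u2; rewrite e4; clear; lra.
(* The threshold 80 enters as [80 ^ 3 / 256 = 2000], which yields [l >= 1000]. *)
have L2 : 2000 * u <= L.
  have : 80 * 80 * (80 * u) <= u ^+ 2 * u ^+ 2 by apply: ler_pM => //; rewrite ?mulr_ge0.
  by move: u4; rewrite e4; clear -u0; lra.
have L3 : 1000 <= L by move: L2 u80; clear; lra.
have u1 : 0 < u by apply: lt_le_trans u80.
have lu : L / (2 * u) * (2 * u) = L by rewrite divfK // gt_eqF // mulr_gt0.
have l1 : 1000 <= L / (2 * u).
  by rewrite ler_pdivlMr ?mulr_gt0 //; move: L2; clear; lra.
move: (L / (2 * u)) lu l1 => l lu l1.
have l0 : 0 < l by move: l1; clear; lra.
split => //.
- rewrite expRN lef_pV2 ?posrE ?expR_gt0 ?ltr0n //.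
  by have := expR_ge1Dx L; move: L3; clear; lra.
- by rewrite -expRD -[leRHS]expR0 ler_expR; move: L3; clear; lra.
move=> k hk.
have lnl : u <= 2 * ln l.
  have -> : 2 * ln l = ln (l ^+ 2) by rewrite lnXn // mulr2n; ring.
  have -> : u = ln L by rewrite Lu expRK.
  rewrite ler_ln ?posrE ?exprn_gt0 // -(ler_pM2r L0).
  have -> : L * L = l ^+ 2 * (4 * u ^+ 2) by rewrite -lu; ring.
  by apply: ler_wpM2l => //; rewrite exprn_ge0 // ltW.
have -> : l = expR (ln l) by rewrite lnK.
rewrite -expRM_natl -expRN -expRM_natl ler_expR.
have h1 : 24 * l * ln l <= k%:R * ln l.
  by apply: ler_wpM2r => //; move: lnl u0; clear; lra.
have h2 : l * u <= l * (2 * ln l) by apply: ler_wpM2l => //; exact: ltW.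
by move: h1 h2; rewrite -lu; clear; lra.
Qed.

Theorem theorem2 (R : realType) :
  exists2 c : R, 0 < c &
    \forall p \near (0 : R)^'+,
      forall (d : measure_display) (T : measurableType d)
        (P : probability T R) (G : T -> rel nat),
        erdos_renyi P p G ->
        ((c * (p ^- 2 / ell p ^+ 4))%:E <= query_number P G triforce)%E.
Proof.
(* The constant 1 suffices because the numerical factors of the estimates are absorbed by
   [1000 <= ell p]. *)
exists 1 => //; near=> p => d T P G GP.
have p0 : 0 < p by near: p; apply: nbhs_right_gt.
have p1 : p < expR (- expR 80) by near: p; apply: nbhs_right_lt; apply: expR_gt0.
have [q1 q2 q3 q4] := @large_ell R p p0 p1.
have l0 : 0 < ell p by lra.
apply: le_ereal_inf_tmp => _ [n [S hS] <-].
rewrite mul1r lee_fin leNgt; apply/negP => hn.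
have := hS; apply/negP; rewrite -ltNge (finds_prob _ _ _ _ _ _ _ GP) lte_fin.
apply: (@Pr_found_lt_half R (next S) p (ell p)) => //.
- rewrite mulrA -ler_pdivlMr ?exprn_gt0 // mulrC -ler_pdivlMl ?exprn_gt0 // mul1r;
    exact: ltW.
- exact: weight_nil.
- by move=> r; apply: prob_ge0.
- by move=> r; apply: weight_cons GP r.
- by move=> r; apply: weight_fresh GP r.
Unshelve. all: by end_near.
Qed.
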